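(* Let $E$ be a real Banach lattice. Every r-Lebesgue (resp., r-$\sigma$-Lebesgue) operator $T:E\to E$ is order continuous (resp., $\sigma$-order continuous).
   Context: A continuous linear operator $T:E\to E$ is Lebesgue (resp., $\sigma$-Lebesgue) if $\|Tx_\alpha\|\to 0$ for every net (resp., sequence) $(x_\alpha)_\alpha$ in $E$ with $x_\alpha\downarrow 0$ (decreasing with infimum $0$). An operator $T:E\to E$ is r-Lebesgue (resp., r-$\sigma$-Lebesgue) if $T=T_1-T_2$ for some positive Lebesgue (resp., positive $\sigma$-Lebesgue) operators $T_1,T_2$ in $E$. A net $(x_\alpha)$ in $E$ order converges to $0$ if there is a net $(y_\beta)$ in $E$ with $y_\beta\downarrow 0$ such that for every $\beta$ there is $\alpha_\beta$ with $|x_\alpha|\le y_\beta$ for all $\alpha\ge\alpha_\beta$; for sequences the dominating net $(y_\beta)$ is taken to be a sequence. An operator is order continuous (resp., $\sigma$-order continuous) if it maps every net (resp., sequence) order convergent to $0$ to a net (resp., sequence) order convergent to $0$. *)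

(* Defs.v *)
From HB Require Import structures.
From mathcomp Require Import all_boot all_order all_algebra.
From mathcomp Require Import all_classical all_reals all_analysis.

Set Implicit Arguments.
Unset Strict Implicit.
Unset Printing Implicit Defensive.

Import Order.TTheory GRing.Theory Num.Theory.
Import numFieldNormedType.Exports.

Local Open Scope classical_set_scope.
Local Open Scope ring_scope.

(* The order is carried by the mixin, rather than inherited from
   [Order.Lattice], because Hierarchy Builder admits no further join of
   [Order.Lattice] and [GRing.Zmodule] below [Num.RealDomain]. The instances
   following the structure turn it into a lattice order in [ring_display], so
   that [x <= y], [Order.meet] and [Order.join] are available on the type. *)
HB.mixin Record isBanachLattice (R : realType) E
    of CompleteNormedModule R E := {
  bl_le : rel E;
  bl_meet : E -> E -> E;
  bl_join : E -> E -> E;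
  bl_le_refl : reflexive bl_le;
  bl_le_anti : antisymmetric bl_le;
  bl_le_trans : transitive bl_le;
  bl_meetP : forall x y z, bl_le x (bl_meet y z) = bl_le x y && bl_le x z;
  bl_joinP : forall x y z, bl_le (bl_join x y) z = bl_le x z && bl_le y z;
  bl_leD2r : forall z x y, bl_le x y -> bl_le (x + z) (y + z);
  bl_scale_ge0 : forall (a : R) x, 0 <= a -> bl_le 0 x -> bl_le 0 (a *: x);
  (* [bl_join x (- x)] is the modulus of x, [`|x|] is its norm *)
  bl_le_norm : forall x y : E,
    bl_le (bl_join x (- x)) (bl_join y (- y)) -> `|x| <= `|y|
}.

#[short(type="banachLatticeType")]
HB.structure Definition BanachLattice (R : realType) :=
  {E of CompleteNormedModule R E & isBanachLattice R E}.

#[non_forgetful_inheritance]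
HB.instance Definition _ (R : realType) (E : banachLatticeType R) :=
  Order.Le_isPOrder.Build ring_display (BanachLattice.sort E)
    (@bl_le_refl R E) (@bl_le_anti R E) (@bl_le_trans R E).

#[non_forgetful_inheritance]
HB.instance Definition _ (R : realType) (E : banachLatticeType R) :=
  Order.POrder_MeetJoin_isLattice.Build ring_display (BanachLattice.sort E)
    (@bl_meetP R E) (@bl_joinP R E).

Section vector_lattice_theory.
Context {R : realType} {E : banachLatticeType R}.
Implicit Types x y z : E.

Definition modulus x : E := Order.join x (- x).

Lemma banach_leD2r z x y : x <= y -> x + z <= y + z.
Proof. exact: bl_leD2r. Qed.

Lemma banach_scale_ge0 (a : R) x : 0 <= a -> 0 <= x -> 0 <= a *: x.
Proof. exact: bl_scale_ge0. Qed.

Lemma banach_le_norm x y : modulus x <= modulus y -> `|x| <= `|y|.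
Proof. exact: bl_le_norm. Qed.

End vector_lattice_theory.

(* A net is a function on a directed preorder. Taking the index set to be a
   [preorderType], i.e., a choiceType with a boolean relation, is no
   restriction classically. *)
Definition directed d (I : preorderType d) :=
  (exists i : I, True) /\
  forall i j : I, exists k : I, (i <= k)%O /\ (j <= k)%O.

Definition tails d (I : preorderType d) : set_system I :=
  filter_from [set: I] (fun i => [set j | (i <= j)%O]).
Arguments tails {d} I _.

Section nets.
Context {R : realType} {E : banachLatticeType R}.

(* Sequences are the case I = nat *)
Definition decreases_to0 d (I : preorderType d) (x : I -> E) :=
  {homo x : i j / (i <= j)%O >-> j <= i} /\ infimums (range x) 0.

Definition eventually_dominated d d' (I : preorderType d) (J : preorderType d')
    (x : I -> E) (y : J -> E) :=
  forall b : J, exists a0 : I, forall a : I, (a0 <= a)%O -> modulus (x a) <= y b.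

Definition order_cvg0 d (I : preorderType d) (x : I -> E) :=
  exists (d' : Order.disp_t) (J : preorderType d') (y : J -> E),
    [/\ directed J, decreases_to0 y & eventually_dominated x y].

Definition sigma_order_cvg0 (x : nat -> E) :=
  exists y : nat -> E, decreases_to0 y /\ eventually_dominated x y.

End nets.

Section operators.
Context {R : realType} {E : banachLatticeType R}.
Implicit Type T : {linear E -> E}.

Definition positive_operator T := forall x : E, 0 <= x -> 0 <= T x.

Definition Lebesgue_operator T :=
  continuous T /\
  forall d (I : preorderType d) (x : I -> E), directed I -> decreases_to0 x ->
    `|T (x i)| @[i --> tails I] --> (0 : R).

Definition sigma_Lebesgue_operator T :=
  continuous T /\
  forall x : nat -> E, decreases_to0 x -> `|T (x n)| @[n --> \oo] --> (0 : R).

Definition r_Lebesgue_operator T :=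
  exists T1 T2 : {linear E -> E},
    [/\ positive_operator T1, Lebesgue_operator T1,
        positive_operator T2, Lebesgue_operator T2 &
        forall x, T x = T1 x - T2 x].

Definition r_sigma_Lebesgue_operator T :=
  exists T1 T2 : {linear E -> E},
    [/\ positive_operator T1, sigma_Lebesgue_operator T1,
        positive_operator T2, sigma_Lebesgue_operator T2 &
        forall x, T x = T1 x - T2 x].

Definition order_continuous T :=
  forall d (I : preorderType d) (x : I -> E), directed I ->
    order_cvg0 x -> order_cvg0 (T \o x).

Definition sigma_order_continuous T :=
  forall x : nat -> E, sigma_order_cvg0 x -> sigma_order_cvg0 (T \o x).

End operators.

(* Main.v *)
Require Import Defs.
From mathcomp Require Import all_boot all_order all_algebra.
From mathcomp Require Import all_classical all_reals all_analysis.

(** The point is that, in a Banach lattice, convergence to 0 in norm of a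
    decreasing net of positive elements forces its infimum to be 0: if l is a
    lower bound, then so is its positive part, whose norm is therefore at most
    that of every term, hence is 0 ([decreases_to0_small_norm]). Consequently
    a positive Lebesgue operator does more than send y decreasing to 0 to a
    norm-null net: it sends it to a net decreasing to 0.

    Now write T = T1 - T2 with both Ti positive and Lebesgue, and let x be
    eventually dominated by y decreasing to 0. Then T1 y + T2 y decreases to 0
    as well ([decreases_to0D]), and it eventually dominates T x because
    |T x| <= T1 |x| + T2 |x| ([eventually_dominated_diff]). The dominating net
    keeps the index set of y, so the sequential statement is the case of
    sequences of the same argument. *)

Set Implicit Arguments.
Unset Strict Implicit.
Unset Printing Implicit Defensive.

Import Order.TTheory GRing.Theory Num.Theory.
Import numFieldNormedType.Exports.

Local Open Scope classical_set_scope.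
Local Open Scope ring_scope.

Section banach_lattice.
Context {R : realType} {E : banachLatticeType R}.
Implicit Types (x y z : E) (T : {linear E -> E}).

Lemma banach_leD x y z t : x <= y -> z <= t -> x + z <= y + t :> E.
Proof.
move=> xy zt; apply: (le_trans (banach_leD2r z xy)).
by rewrite ![y + _]addrC; exact: banach_leD2r.
Qed.

Lemma banach_subr_ge0 x y : (0 <= y - x) = (x <= y).
Proof.
apply/idP/idP => [/(banach_leD2r x)|/(banach_leD2r (- x))].
  by rewrite add0r subrK.
by rewrite subrr.
Qed.

Lemma banach_oppr_le0 x : 0 <= x -> - x <= 0.
Proof. by move=> /(banach_leD2r (- x)); rewrite add0r subrr. Qed.

Lemma modulus_id x : 0 <= x -> modulus x = x.
Proof.
move=> x0; apply/eqP; rewrite eq_joinl.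
exact: (le_trans (banach_oppr_le0 x0)).
Qed.

Lemma banach_ge0_le_norm x y : 0 <= x -> x <= y -> `|x| <= `|y|.
Proof.
move=> x0 xy; apply: banach_le_norm.
by rewrite !modulus_id//; exact: le_trans xy.
Qed.

Lemma positive_operator_le T x y :
  positive_operator T -> x <= y -> T x <= T y.
Proof.
by move=> T0 xy; rewrite -banach_subr_ge0 -linearB T0// banach_subr_ge0.
Qed.

Section nets.
Context {d : Order.disp_t} {I : preorderType d}.
Implicit Types u v : I -> E.

Lemma decreases_to0_ge0 u i : decreases_to0 u -> 0 <= u i.
Proof. by move=> [_ [+ _]]; apply; exists i. Qed.

(** A lower bound l has positive part below every term of the net, and the
    norm is monotone on positive elements, so that positive part is 0. *)
Lemma decreases_to0_small_norm u :
  {homo u : i j / (i <= j)%O >-> j <= i} -> (forall i, 0 <= u i) ->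
  (forall e : R, 0 < e -> exists i, `|u i| < e) ->
  decreases_to0 u.
Proof.
move=> u_dec u_ge0 u_small; split=> //; split=> [_ [i _ <-]//|l l_lb].
suff /eqP <- : Order.join l 0 == 0 by exact: leUl.
rewrite -normr_le0 leNgt; apply/negP => /u_small[i]; apply/negP; rewrite -leNgt.
apply: banach_ge0_le_norm; first exact: leUr.
by rewrite leUx u_ge0 andbT; apply: l_lb; exists i.
Qed.

(** Directedness allows the two indices to be separated: l <= u i + v i for
    all i gives l <= u i + v j for all i and j, after which the infimum can be
    taken in i first and in j next. *)
Lemma decreases_to0D u v : directed I ->
  decreases_to0 u -> decreases_to0 v -> decreases_to0 (u \+ v).
Proof.
move=> [_ I_dir] u0 v0.
have [[u_dec [_ u_inf]] [v_dec [_ v_inf]]] := (u0, v0).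
split=> [i j ij|]; first exact: banach_leD (u_dec _ _ ij) (v_dec _ _ ij).
split=> [_ [i _ <-]|l l_lb].
  rewrite -[X in X <= _](addr0 (0 : E)).
  by apply: banach_leD; exact: decreases_to0_ge0.
apply: v_inf => _ [j _ <-].
suff : l - v j <= 0 by move=> /(banach_leD2r (v j)); rewrite subrK add0r.
apply: u_inf => _ [i _ <-]; have [k [ik jk]] := I_dir i j.
rewrite -[u i](addrK (v j)); apply: banach_leD2r.
apply: (@le_trans _ _ (u k + v k)); first by apply: l_lb; exists k.
exact: banach_leD (u_dec _ _ ik) (v_dec _ _ jk).
Qed.

Lemma positive_decreases_to0 T u : positive_operator T -> decreases_to0 u ->
  (forall e : R, 0 < e -> exists i, `|T (u i)| < e) ->
  decreases_to0 (T \o u).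
Proof.
move=> T0 u0; apply: decreases_to0_small_norm => [i j ij|i] /=.
  by apply: positive_operator_le => //; exact: u0.1.
exact/T0/decreases_to0_ge0.
Qed.

Lemma Lebesgue_decreases_to0 T u : positive_operator T ->
  Lebesgue_operator T -> directed I -> decreases_to0 u ->
  decreases_to0 (T \o u).
Proof.
move=> T0 [_ TL] I_dir u0; apply: positive_decreases_to0 => // e e0.
have [i _] := TL _ _ _ I_dir u0 _ (nbhsx_ballx _ _ e0).
by move/(_ i (lexx _)); rewrite /ball/= sub0r normrN normr_id; exists i.
Qed.

(** Since T is T1 - T2 with both Ti positive, |T x| <= T1 |x| + T2 |x|. *)
Lemma eventually_dominated_diff T T1 T2 d' (J : preorderType d')
    (x : J -> E) u :
  positive_operator T1 -> positive_operator T2 ->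
  (forall z, T z = T1 z - T2 z) ->
  eventually_dominated x u ->
  eventually_dominated (T \o x) ((T1 \o u) \+ (T2 \o u)).
Proof.
move=> T1_ge0 T2_ge0 TE xu b; have [a xa] := xu b; exists a => c /xa.
rewrite /modulus !leUx /= => /andP[xb nxb].
rewrite TE opprB -!linearN [X in _ && (X <= _)]addrC.
by rewrite !banach_leD// positive_operator_le.
Qed.

End nets.

Lemma sigma_Lebesgue_decreases_to0 T (u : nat -> E) : positive_operator T ->
  sigma_Lebesgue_operator T -> decreases_to0 u -> decreases_to0 (T \o u).
Proof.
move=> T0 [_ TL] u0; apply: positive_decreases_to0 => // e e0.
have [n _] := TL _ u0 _ (nbhsx_ballx _ _ e0).
by move/(_ n (leqnn _)); rewrite /ball/= sub0r normrN normr_id; exists n.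
Qed.

End banach_lattice.

Lemma directed_nat : directed nat.
Proof.
by split=> [|i j]; [exists 0%N|exists (maxn i j); rewrite !leEnat leq_maxl leq_maxr].
Qed.

Theorem proposition1 (R : realType) (E : banachLatticeType R)
    (T : {linear E -> E}) :
  (r_Lebesgue_operator T -> order_continuous T) /\
  (r_sigma_Lebesgue_operator T -> sigma_order_continuous T).
Proof.
split=> [[T1 [T2 [T1_ge0 T1L T2_ge0 T2L TE]]] d I x _ [d' [J [y [Jdir y0 xy]]]]|].
  exists d', J, ((T1 \o y) \+ (T2 \o y)); split=> //.
    by apply: decreases_to0D => //; exact: Lebesgue_decreases_to0.
  exact: eventually_dominated_diff.
move=> [T1 [T2 [T1_ge0 T1L T2_ge0 T2L TE]]] x [y [y0 xy]].
exists ((T1 \o y) \+ (T2 \o y)); split; last exact: eventually_dominated_diff.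
apply: decreases_to0D; first exact: directed_nat.
  exact: sigma_Lebesgue_decreases_to0.
exact: sigma_Lebesgue_decreases_to0.
Qed.
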